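(* Let $k\ge 0$ and $\delta\ge k+2$ be integers, and let $n$ be sufficiently large (i.e. $n\ge n_0(k,\delta)$ for some $n_0$ depending only on $k$ and $\delta$). If $G$ is an $n$-vertex graph with minimum degree $\delta(G)\ge\delta$ and $$q(G)\ge 2(n-\delta+k-1),$$ then $G$ is $k$-Hamiltonian unless $G\in\mathcal{H}_{n,k,\delta}^{(1)}$ or $G\in\mathcal{L}_{n,k,\delta}^{(1)}$.
   Context: All graphs are finite and simple, considered up to isomorphism. $q(G)$ is the signless Laplacian spectral radius, i.e. the largest eigenvalue of $Q(G)=D(G)+A(G)$, where $A(G)$ is the adjacency matrix and $D(G)$ the diagonal matrix of vertex degrees. $K_s$ is the complete graph on $s$ vertices, $I_t$ is the edgeless graph on $t$ vertices, $G\cup H$ is the disjoint union, and $G\vee H$ is the join (obtained from $G\cup H$ by adding all edges between $G$ and $H$). A graph is Hamiltonian if it has a Hamilton cycle (a cycle through all vertices). A graph $G=(V,E)$ is $k$-Hamiltonian if for all $S\subseteq V$ with $|S|\le k$, the subgraph induced by $V\setminus S$ is Hamiltonian. Define $H_{n,k,\delta}:=K_\delta\vee(K_{n-2\delta+k}\cup I_{\delta-k})$. In it, let $X$ be the set of $\delta-k$ vertices (of degree $\delta$) of $I_{\delta-k}$, $Y$ the set of $\delta$ vertices (of degree $n-1$) of $K_\delta$, and $Z$ the set of the remaining $n-2\delta+k$ vertices (of degree $n-\delta+k-1$). Let $E_1(H_{n,k,\delta})$ be the set of edges with both endpoints in $Y\cup Z$, and $$\mathcal{H}_{n,k,\delta}^{(1)}=\{H_{n,k,\delta}\setminus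 E' : E'\subseteq E_1(H_{n,k,\delta}),\ |E'|\le\lfloor\delta(\delta-k)/4\rfloor\},$$ where $G\setminus E'$ means deleting the edges of $E'$. Define $L_{n,k,\delta}:=K_{k+1}\vee(K_{n-\delta-1}\cup K_{\delta-k})$. In it, let $X$ be the set of vertices (of degree $\delta$) of $K_{\delta-k}$, $Y$ the set of vertices (of degree $n-1$) of $K_{k+1}$, and $Z$ the set of the remaining $n-\delta-1$ vertices (of degree $n-\delta+k-1$). Let $E_1(L_{n,k,\delta})$ be the set of edges with both endpoints in $Y\cup Z$, and $$\mathcal{L}_{n,k,\delta}^{(1)}=\{L_{n,k,\delta}\setminus E' : E'\subseteq E_1(L_{n,k,\delta}),\ |E'|\le\lfloor(k+1)(\delta-k)/4\rfloor\}.$$ *)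

(* Defs.v *)
From HB Require Import structures.
From mathcomp Require Import all_boot all_order all_algebra.
From mathcomp Require Import reals.
From mathcomp Require Import complex.

Set Implicit Arguments.
Unset Strict Implicit.
Unset Printing Implicit Defensive.

Import Order.TTheory GRing.Theory Num.Theory.

Record sgraph (T : finType) := SGraph {
  adj :> rel T;
  adj_sym : symmetric adj;
  adj_irr : irreflexive adj }.

Definition graph_iso (T1 T2 : finType) (G : sgraph T1) (H : sgraph T2) : Prop :=
  exists2 f : T1 -> T2, bijective f & forall x y, H (f x) (f y) = G x y.

Section Constructions.
Implicit Types T : finType.

Definition complete_rel T : rel T := fun x y => x != y.

Lemma complete_sym T : symmetric (@complete_rel T).
Proof. by move=> x y; rewrite /complete_rel eq_sym. Qed.

Lemma complete_irr T : irreflexive (@complete_rel T).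
Proof. by move=> x; rewrite /complete_rel eqxx. Qed.

Definition complete (s : nat) : sgraph 'I_s :=
  SGraph (@complete_sym 'I_s) (@complete_irr 'I_s).

Definition edgeless_rel T : rel T := fun _ _ => false.

Definition edgeless (t : nat) : sgraph 'I_t :=
  @SGraph 'I_t (@edgeless_rel 'I_t) (fun _ _ => erefl) (fun _ => erefl).

(* [b] tells whether the two sides are fully connected or not connected. *)
Definition sum_rel (b : bool) T1 T2 (G : sgraph T1) (H : sgraph T2) :
    rel (T1 + T2)%type :=
  fun u v => match u, v with
             | inl x, inl y => G x y
             | inr x, inr y => H x y
             | _, _ => b
             end.

Lemma sum_sym b T1 T2 (G : sgraph T1) (H : sgraph T2) : symmetric (sum_rel b G H).
Proof. by case=> x [] y //=; apply: adj_sym. Qed.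

Lemma sum_irr b T1 T2 (G : sgraph T1) (H : sgraph T2) :
  irreflexive (sum_rel b G H).
Proof. by case=> x /=; apply: adj_irr. Qed.

Definition disjoint_union T1 T2 (G : sgraph T1) (H : sgraph T2) :=
  SGraph (sum_sym false G H) (sum_irr false G H).

Definition graph_join T1 T2 (G : sgraph T1) (H : sgraph T2) :=
  SGraph (sum_sym true G H) (sum_irr true G H).

Definition induced_rel T (G : sgraph T) (A : {set T}) : rel {x : T | x \in A} :=
  fun x y => G (val x) (val y).

Lemma induced_sym T (G : sgraph T) A : symmetric (@induced_rel T G A).
Proof. by move=> x y; apply: adj_sym. Qed.

Lemma induced_irr T (G : sgraph T) A : irreflexive (@induced_rel T G A).
Proof. by move=> x; apply: adj_irr. Qed.

Definition induced T (G : sgraph T) (A : {set T}) : sgraph {x : T | x \in A} :=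
  SGraph (@induced_sym T G A) (@induced_irr T G A).

(* An edge is represented by the unordered pair of its endpoints. *)
Definition edges T (G : sgraph T) : {set {set T}} :=
  [set [set p.1; p.2] | p : T * T & G p.1 p.2].

Definition delete_rel T (G : sgraph T) (E : {set {set T}}) : rel T :=
  fun x y => G x y && ([set x; y] \notin E).

Lemma delete_sym T (G : sgraph T) E : symmetric (delete_rel G E).
Proof. by move=> x y; rewrite /delete_rel adj_sym setUC. Qed.

Lemma delete_irr T (G : sgraph T) E : irreflexive (delete_rel G E).
Proof. by move=> x; rewrite /delete_rel adj_irr. Qed.

Definition delete_edges T (G : sgraph T) (E : {set {set T}}) : sgraph T :=
  SGraph (delete_sym G E) (delete_irr G E).

End Constructions.

Section Invariants.
Variables (T : finType) (G : sgraph T).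

Definition degree (x : T) : nat := #|[set y | G x y]|.

Definition min_degree_ge (d : nat) : Prop := forall x, d <= degree x.

(* The length condition rules out the degenerate "cycles" of [path.v]: the
   empty one, and a single edge traversed back and forth. *)
Definition hamiltonian : Prop :=
  exists c : seq T, [/\ 2 < size c, uniq c, cycle G c & forall x, x \in c].

End Invariants.

Definition k_hamiltonian (T : finType) (G : sgraph T) (k : nat) : Prop :=
  forall S : {set T}, #|S| <= k -> hamiltonian (induced G (~: S)).

Section SignlessLaplacian.
Local Open Scope ring_scope.
Variable R : rcfType.

Definition adjacency_mx n (G : sgraph 'I_n) : 'M[R]_n :=
  \matrix_(i, j) (G i j)%:R.

Definition degree_mx n (G : sgraph 'I_n) : 'M[R]_n :=
  diag_mx (\row_i (degree G i)%:R).

Definition signless_laplacian n (G : sgraph 'I_n) : 'M[R]_n :=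
  degree_mx G + adjacency_mx G.

Definition largest_eigenvalue n (A : 'M[R]_n) (q : R) : Prop :=
  eigenvalue A q /\ forall a, eigenvalue A a -> a <= q.

(* [signless_radius G q] reads q(G) = q. *)
Definition signless_radius n (G : sgraph 'I_n) (q : R) : Prop :=
  largest_eigenvalue (signless_laplacian G) q.

Lemma signless_laplacian_sym n (G : sgraph 'I_n) :
  (signless_laplacian G)^T = signless_laplacian G.
Proof.
apply/matrixP => i j; rewrite !mxE adj_sym eq_sym.
by case: eqP => [->|].
Qed.

Lemma sym_has_eigenvalue n (A : 'M[R]_n) :
  (0 < n)%N -> A^T = A -> exists a, eigenvalue A a.
Proof.
move=> n0 sA; pose f := real_complex R.
have [z /eigenvalueP[v vA v0]] := eigenvalue_closed (map_mx f A) n0.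
pose w := map_mx Num.conj v.
have cA : map_mx Num.conj (map_mx f A) = map_mx f A.
  by apply/matrixP=> i j; rewrite !mxE; apply/conj_Creal/complex_realP; exists (A i j).
have wA : w *m map_mx f A = z^* *: w.
  by rewrite -cA -map_mxM vA map_mxZ.
have e1 : w *m (map_mx f A) *m v^T = z *: (w *m v^T).
  have sf : (map_mx f A)^T = map_mx f A by rewrite map_trmx sA.
  by rewrite -mulmxA -{1}sf -trmx_mul vA linearZ /= -scalemxAr.
have /matrixP/(_ 0 0) : (z^* - z) *: (w *m v^T) = 0.
  by rewrite scalerBl -e1 wA -scalemxAl subrr.
rewrite !mxE => /eqP; rewrite mulf_eq0 subr_eq0 => /orP[/eqP zr|].
  have /complex_realP[a za] : z \is Num.real by rewrite CrealE zr.
  exists a; rewrite -(eigenvalue_map (real_complex R)); apply/eigenvalueP.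
  by exists v; rewrite // vA za.
rewrite psumr_eq0 => [|i _]; last by rewrite !mxE mulrC mul_conjC_ge0.
move=> /allP h; case/negP: v0; apply/eqP/rowP => j; rewrite mxE.
have := h j; rewrite mem_index_enum => /(_ isT) /=.
by rewrite !mxE mulrC mul_conjC_eq0 => /eqP.
Qed.

Lemma signless_radius_exists n (G : sgraph 'I_n) :
  (0 < n)%N -> exists q, signless_radius G q.
Proof.
move=> n0; have [a0 ha0] := sym_has_eigenvalue n0 (signless_laplacian_sym G).
rewrite /signless_radius; move: (signless_laplacian G) ha0 => A ha0.
pose p := char_poly A.
have p0 : p != 0 by rewrite monic_neq0 // char_poly_monic.
have [s hs] := closed_field_poly_normal (map_poly (real_complex R) p).
pose t := [seq a <- [seq complex.Re z | z <- s] | eigenvalue A a].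
have tP a : (a \in t) = eigenvalue A a.
  rewrite mem_filter; apply/andb_idr => ha; apply/mapP.
  exists (real_complex R a) => //.
  have : root (map_poly (real_complex R) p) (real_complex R a).
    by rewrite fmorph_root -eigenvalue_root_char.
  by rewrite hs rootZ ?root_prod_XsubC // lead_coef_eq0 map_poly_eq0.
have : a0 \in t by rewrite tP.
case E : t => [//|b u] _.
pose q := \big[Num.max/b]_(x <- u) x.
exists q; split; last first.
  move=> a; rewrite -tP E inE => /orP[/eqP->|au]; first exact: bigmax_ge_id.
  exact: le_bigmax_seq.
rewrite -tP E /q; rewrite big_seq; elim/big_ind: _ => [|x y hx hy|].
- exact: mem_head.
- by rewrite /Num.max; case: ifP.
- by move=> x xu; rewrite inE xu orbT.
Qed.

End SignlessLaplacian.

Section Families.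
Variables n k delta : nat.

(* K_delta \/ (K_(n - 2 delta + k) U I_(delta - k)); the three summands of the
   vertex type are Y, Z and X, in this order. *)
Definition H_graph :=
  graph_join (complete delta)
    (disjoint_union (complete (n + k - 2 * delta)) (edgeless (delta - k))).

(* K_(k+1) \/ (K_(n - delta - 1) U K_(delta - k)), summands Y, Z and X again. *)
Definition L_graph :=
  graph_join (complete k.+1)
    (disjoint_union (complete (n - delta - 1)) (complete (delta - k))).

End Families.

Definition YZ (TY TZ TX : finType) : {set TY + (TZ + TX)} :=
  [set v | if v is inr (inr _) then false else true].

Definition E1 (TY TZ TX : finType) (G : sgraph (TY + (TZ + TX))%type) :
    {set {set TY + (TZ + TX)}} :=
  [set e in edges G | e \subset YZ TY TZ TX].

Definition in_family1 (T TY TZ TX : finType) (G : sgraph T)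
    (G0 : sgraph (TY + (TZ + TX))%type) (m : nat) : Prop :=
  exists E' : {set {set TY + (TZ + TX)}},
    [/\ E' \subset E1 G0, #|E'| <= m & graph_iso G (delete_edges G0 E')].

Definition in_H1 (T : finType) (n k delta : nat) (G : sgraph T) : Prop :=
  in_family1 G (H_graph n k delta) (delta * (delta - k) %/ 4).

Definition in_L1 (T : finType) (n k delta : nat) (G : sgraph T) : Prop :=
  in_family1 G (L_graph n k delta) (k.+1 * (delta - k) %/ 4).

(* Main.v *)
(* Put s = delta - k. At a vertex u maximizing |v u| / d(u) for an eigenvector v,
   the eigenvalue equation bounds q by d(u) plus the average degree of the
   neighbours of u; this leaves at most s n missing edges in G. If G - S with
   |S| <= k is not Hamiltonian, adding edges according to Ore's condition makes
   all but a set X of low-degree vertices a clique; counting missing edges and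
   degrees gives |X| = s, |S| = k, and every vertex of X is joined to the same y
   vertices outside X of G - S. If 1 < y < s, contracting the rest of the clique
   to a point gives a graph so small that Ore's condition applies to it again,
   and G - S is Hamiltonian. The case y = s is a subgraph of H, y = 1 of L.

   For the number D of edges missing outside X, normalize max |v| = 1. Then v
   is O(1/n) on X and 1 - O(1/n) elsewhere, and the sum of (q - 2 d(i)) v(i)
   over all i vanishes. With q >= 2 (n - s - 1) this reads 4 D <= M + O(1/n),
   M being the number of edges leaving X, so 4 D <= M by integrality. *)
Require Import Defs.
From mathcomp Require Import all_boot all_order all_algebra.
From mathcomp Require Import reals.
From mathcomp Require Import boolp zify ring lra.

Set Implicit Arguments.
Unset Strict Implicit.
Unset Printing Implicit Defensive.

Import Order.TTheory GRing.Theory Num.Theory.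

(** * Hamiltonicity and Ore closure *)

Lemma has_zip_belast (T : Type) (P : rel T) u p :
  has (fun ab => P ab.1 ab.2) (zip (belast u p) p) ->
  exists p1 b p2, p = p1 ++ b :: p2 /\ P (last u p1) b.
Proof.
elim: p u => //= b p IH u /orP[Pub|/IH[p1 [c [p2 [-> ?]]]]].
  by exists [::], b, p.
by exists (b :: p1), c, p2.
Qed.

Section Hamiltonicity.
Variable T : finType.
Implicit Types (G H : sgraph T) (u v x y : T).

Lemma degree_count G x (s : seq T) :
  uniq s -> (forall y, y \in s) -> degree G x = count (G x) s.
Proof.
move=> us als; rewrite -size_filter -(card_uniqP (filter_uniq _ us)).
by apply: eq_card => y; rewrite !inE mem_filter als andbT.
Qed.

(** Ore's crossing argument: the path has #|T| - 1 consecutive pairs [(a, b)]. By the degree sum,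
    some pair has both [v] adjacent to [a] and [u] adjacent to [b]. *)
Lemma ore_path G u p :
  uniq (u :: p) -> (forall x, x \in u :: p) -> path G u p -> 1 < size p ->
  #|T| <= degree G u + degree G (last u p) -> hamiltonian G.
Proof.
move=> us als pp sp hd; set v := last u p in hd.
have sT : #|T| = (size p).+1.
  by rewrite -[RHS](card_uniqP us); apply: eq_card => x; rewrite als.
have du : degree G u = count (G u) p.
  by rewrite (degree_count G u us als) /= adj_irr.
have dv : degree G v = count (G v) (belast u p).
  by rewrite (degree_count G v us als) lastI -cats1 count_cat /= adj_irr !addn0.
pose z := zip (belast u p) p.
have sz : size z = size p by rewrite size_zip size_belast minnn.
have : has (fun ab => G v ab.1 && G u ab.2) z.
  rewrite has_count; have := count_predUI (G v \o fst) (G u \o snd) z.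
  have -> : count (G v \o fst) z = degree G v.
    by rewrite -count_map [map _ _]unzip1_zip ?size_belast // -dv.
  have -> : count (G u \o snd) z = degree G u.
    by rewrite -count_map [map _ _]unzip2_zip ?size_belast // -du.
  have := count_size (predU (G v \o fst) (G u \o snd)) z.
  rewrite sz; set m := count (predI _ _) _ => h1 h2.
  by have : 0 < m by lia.
move=> /(@has_zip_belast _ (fun a b => G v a && G u b)).
move=> [p1 [b [p2 [ep /andP[va ub]]]]].
have eqs : perm_eq (u :: p1 ++ rev (b :: p2)) (u :: p).
  by rewrite ep perm_cons perm_cat2l perm_rev.
(* The cycle follows the path from [u] to [a], jumps to its end [v], walks back to [b] and closes
   with the edge from [b] to [u]. *)
exists (u :: p1 ++ rev (b :: p2)); split.
- by rewrite (perm_size eqs).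
- by rewrite (perm_uniq eqs).
- move: pp; rewrite ep cat_path /= => /and3P[pp1 _ pp2].
  rewrite rcons_cat cat_path pp1 /= lastI rev_rcons.
  have -> : last b p2 = v by rewrite /v ep last_cat.
  rewrite /= (adj_sym G _ v) va /= rcons_path.
  have -> : path G v (rev (belast b p2)).
    rewrite /v ep last_cat /= rev_path.
    by rewrite (eq_path (e' := G)) // => x y; rewrite adj_sym.
  case: p2 {eqs pp2} ep => [|c p2] ep /=; last by rewrite rev_cons last_rcons adj_sym.
  by rewrite /v ep last_cat /= adj_sym.
- by move=> x; rewrite (perm_mem eqs).
Qed.

(** The guard [u != v] keeps the relation irreflexive: for [u = v] nothing is added. *)
Definition add_edge_rel G u v : rel T :=
  fun x y => G x y || (u != v) && ([set x; y] == [set u; v]).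

Lemma add_edge_sym G u v : symmetric (add_edge_rel G u v).
Proof. by move=> x y; rewrite /add_edge_rel adj_sym (setUC [set x]). Qed.

Lemma add_edge_irr G u v : irreflexive (add_edge_rel G u v).
Proof.
move=> x; rewrite /add_edge_rel adj_irr setUid.
apply/negP=> /andP[uv /eqP/setP e]; case/negP: uv.
by move: (e u) (e v); rewrite !inE !eqxx orbT /= => /eqP-> /eqP->.
Qed.

Definition add_edge G u v : sgraph T :=
  SGraph (add_edge_sym G u v) (add_edge_irr G u v).

Lemma add_edge_avoid G u v x y :
  x != u -> y != u -> add_edge G u v x y -> G x y.
Proof.
move=> xu yu /orP[//|/andP[_ /eqP/setP/(_ u)]].
by rewrite !inE eqxx !(eq_sym u) (negPf xu) (negPf yu).
Qed.

Lemma add_edge_end G u v y : y != v -> add_edge G u v u y -> G u y.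
Proof.
move=> yv /orP[//|/andP[uv /eqP/setP/(_ v)]].
by rewrite !inE eqxx !(eq_sym v) (negPf uv) (negPf yv) orbT.
Qed.

Lemma path_add_edge G u v a p :
  u \notin a :: p -> path (add_edge G u v) a p -> path G a p.
Proof.
elim: p a => //= b p IH a; rewrite !inE !negb_or => /and3P[ua ub up].
case/andP=> hab hp; rewrite IH ?inE ?negb_or ?ub ?andbT //.
by apply: add_edge_avoid hab; rewrite eq_sym.
Qed.

Lemma ore_step G u v :
  ~~ G u v -> #|T| <= degree G u + degree G v ->
  hamiltonian (add_edge G u v) -> hamiltonian G.
Proof.
move=> nuv hd [c [sc uc cc ac]].
have [i p ec] := rot_to (ac u).
have {sc uc cc ac}[sp us cs als] : [/\ 1 < size p, uniq (u :: p),
    cycle (add_edge G u v) (u :: p) & forall x, x \in u :: p].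
  split; rewrite -?ec ?rot_uniq ?rot_cycle //.
    by rewrite -ltnS -[(size p).+1]/(size (u :: p)) -ec size_rot.
  by move=> x; rewrite mem_rot.
(* If the new edge closes the cycle, removing it leaves a Hamilton path of [G] from [u] to [v], to
   which [ore_path] applies. If [v] comes right after [u], the cycle is reversed below. *)
have last_case q : 1 < size q -> uniq (u :: q) -> (forall x, x \in u :: q) ->
    cycle (add_edge G u v) (u :: q) -> last u q = v -> hamiltonian G.
  move=> sq uq aq cq lq; apply: (@ore_path G u q) => //; last by rewrite lq.
  case: q sq uq {aq} cq lq => [|a [|b q]] // _ uq.
  rewrite /= rcons_path => /and4P[ha hb hq _] lq.
  have anv : a != v.
    apply: contraTneq uq => -> /=; rewrite -lq /=.
    by rewrite mem_last /= andbF.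
  rewrite /= (add_edge_end anv ha) /=.
  move: uq => /= /and3P[uq _ _].
  by apply: (@path_add_edge G u v a (b :: q)) => /=; first exact: uq; apply/andP; split.
case: (eqVneq (last u p) v) => [|lv]; first exact: last_case.
case: p sp us cs als lv {ec} => [|a p] // sp us cs als lv.
case: (eqVneq a v) => [av|av].
  have eqs : perm_eq (u :: rev (a :: p)) (u :: a :: p).
    by rewrite perm_cons perm_rev.
  apply: (last_case (rev (a :: p))); rewrite ?size_rev ?(perm_uniq eqs) //.
  - by move=> x; rewrite (perm_mem eqs).
  - rewrite -(rot_cycle 1) rot1_cons -rev_cons rev_cycle.
    by rewrite (eq_cycle (e' := add_edge G u v)) // => x y; rewrite adj_sym.
  - by rewrite rev_cons last_rcons.
(* Neither cyclic neighbour of [u] is [v], so the cycle does not use the new edge. *)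
move: cs; rewrite /= rcons_path => /and3P[ua pp pl].
exists (u :: a :: p); split => //.
rewrite /= (add_edge_end av ua) rcons_path.
move: (us) => /= /andP[uap _]; rewrite (path_add_edge uap pp) /=.
rewrite adj_sym; apply: (@add_edge_end _ _ v); first exact: lv.
by rewrite adj_sym.
Qed.

Definition ore_closed G :=
  forall u v, u != v -> ~~ G u v -> degree G u + degree G v < #|T|.

Lemma degree_sub G H x : subrel G H -> degree G x <= degree H x.
Proof. by move=> GH; apply/subset_leq_card/subsetP => y; rewrite !inE; apply: GH. Qed.

(** The Bondy-Chvátal closure: edges are added by [ore_step] as long as possible, and each addition
    lowers the number of ordered nonadjacent pairs. *)
Lemma ore_closure G :
  exists H, [/\ subrel G H, ore_closed H & hamiltonian H -> hamiltonian G].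
Proof.
have [m] := ubnP #|[set p : T * T | ~~ G p.1 p.2]|; elim: m G => // m IH G.
rewrite ltnS => hm.
case: (boolP [exists u, exists v,
    [&& u != v, ~~ G u v & #|T| <= degree G u + degree G v]]); last first.
  move=> /existsPn h; exists G; split=> // u v uv nuv.
  by have /existsPn/(_ v) := h u; rewrite uv nuv /= -ltnNge.
case/existsP=> u /existsP[v /and3P[uv nuv hd]].
have subG : subrel G (add_edge G u v) by move=> x y /= xy; rewrite /add_edge_rel xy.
have [|H [sH cH hH]] := IH (add_edge G u v).
  apply: leq_trans hm; apply: proper_card; apply/properP; split.
    by apply/subsetP=> p; rewrite !inE; apply: contra => /subG.
  exists (u, v); first by rewrite inE.
  by rewrite inE /= /add_edge_rel uv eqxx orbT.
exists H; split=> // [x y /subG/sH //|/hH].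
exact: ore_step.
Qed.

Lemma path_clique G a p :
  uniq (a :: p) -> {in a :: p &, forall x y, x != y -> G x y} -> path G a p.
Proof.
elim: p a => //= b p IH a /andP[]; rewrite inE negb_or => /andP[ab _] up hG.
rewrite hG ?inE ?eqxx ?orbT //=; apply: IH => // x y xp yp.
by apply: hG; rewrite inE (xp, yp) orbT.
Qed.

Lemma hamiltonian_complete G :
  2 < #|T| -> (forall x y, x != y -> G x y) -> hamiltonian G.
Proof.
move=> T2 cG; exists (enum T); split; rewrite ?enum_uniq -?cardE //; last first.
  by move=> x; rewrite mem_enum.
move: (enum_uniq T) T2; rewrite cardE; case: (enum T) => //= a p ap p2.
rewrite rcons_path path_clique //=; last by move=> x y _ _; apply: cG.
case: p ap p2 => [|b p] // /andP[ap _] _.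
by apply: cG; apply: contraNneq ap => <- /=; rewrite mem_last.
Qed.

(* A Hamilton cycle through one vertex [z] of a clique [Z] of twins (towards
   [A]) is extended to all of [Z] by visiting the rest of [Z] after [z]. *)
Lemma hamiltonian_blowup G (A Z : {set T}) z :
  z \in Z -> A = ~: Z -> {in Z &, forall x y, x != y -> G x y} ->
  (forall x y, x \in Z -> y \in A -> G z y -> G x y) ->
  hamiltonian (induced G (z |: A)) -> hamiltonian G.
Proof.
move=> zZ eA cZ tw [c0 [sc uc cc ac]].
pose c := map val c0.
have {}uc : uniq c by rewrite map_inj_uniq //; apply: val_inj.
have {}cc : cycle G c by rewrite /c cycle_map.
have mc x : (x \in c) = (x \in z |: A).
  apply/mapP/idP => [[y _ ->]|xA]; first exact: valP.
  by exists (Sub x xA).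
have {}sc : 2 < size c by rewrite size_map.
have zc : z \in c by rewrite mc !inE eqxx.
have [i p ec] := rot_to zc.
move: sc uc cc; rewrite -(size_rot i) -(rot_uniq i) -(rot_cycle i) ec => sp up cp.
have {}mc x : (x \in z :: p) = (x \in z |: A) by rewrite -ec mem_rot mc.
have mp x : (x \in p) = (x \in A).
  have := mc x; rewrite !inE; case: (eqVneq x z) => [-> _|//].
  by move: up => /= /andP[/negPf-> _]; rewrite eA inE zZ.
pose q := enum (Z :\ z).
have mq x : (x \in q) = (x != z) && (x \in Z) by rewrite mem_enum !inE.
exists (z :: q ++ p); split.
- by apply: leq_trans sp _; rewrite /= size_cat ltnS leq_addl.
- move: up; rewrite /= mem_cat mq eqxx /= => /andP[-> up] /=.
  rewrite cat_uniq enum_uniq up andbT /=; apply/hasPn => x.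
  by rewrite mp mq eA inE => /negPf->; rewrite andbF.
- rewrite /= rcons_cat cat_path path_clique /=; last first.
  + move=> x y; rewrite !inE !mq => hx hy; apply: cZ.
      by case/orP: hx => [/eqP->//|/andP[]].
    by case/orP: hy => [/eqP->//|/andP[]].
  + by rewrite mq eqxx enum_uniq.
  case: p {ec} sp up cp mc mp => [|y p] // _ _ /= /andP[zy ->] _ mp.
  rewrite andbT; apply: tw => //; last by rewrite -mp mem_head.
  have := mem_last z q; rewrite inE mq => /orP[/eqP->//|/andP[] //].
- move=> x; rewrite inE mem_cat mq mp eA inE.
  by case: (x == z) => //=; case: (x \in Z).
Qed.

End Hamiltonicity.

(** * Structure of non-Hamiltonian graphs with few missing edges *)

Lemma card_induced (T : finType) (A : {set T}) : #|{: {x : T | x \in A}}| = #|A|.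
Proof. by rewrite card_sig; apply: eq_card => x; rewrite inE. Qed.

Lemma degree_induced (T : finType) (G : sgraph T) (A : {set T})
    (x : {x : T | x \in A}) :
  degree (induced G A) x = #|[set y in A | G (val x) y]|.
Proof.
rewrite /degree -(card_imset _ val_inj); apply: eq_card => y.
rewrite [RHS]inE; apply/imsetP/andP => [[z]|[yA xy]].
  by rewrite inE => xz ->; split; [exact: valP | exact: xz].
by exists (Sub y yA) => //; rewrite inE.
Qed.

Lemma card_induced_set (T : finType) (A D : {set T}) :
  D \subset A -> #|[set u : {x : T | x \in A} | val u \in D]| = #|D|.
Proof.
move=> /subsetP DA; rewrite -(card_imset _ val_inj); apply: eq_card => u.
apply/imsetP/idP => [[u' ]|uD]; first by rewrite inE => u'D ->.
by exists (Sub u (DA u uD)); rewrite // inE.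
Qed.

Section Structure.
Variables (T : finType) (G : sgraph T) (n : nat).
Hypothesis nT : #|T| = n.

(** Degree in the complement graph; its sum over all vertices is twice the number of missing
    edges. *)
Definition codegree (x : T) : nat := #|[set y | (x != y) && ~~ G x y]|.

Lemma degree_codegree x : (degree G x + codegree x).+1 = n.
Proof.
rewrite -nT -addnS -cardsT -(cardsID [set y | G x y] setT) setTI; congr addn.
rewrite (cardsD1 x) !inE adj_irr /= add1n; congr _.+1.
by apply: eq_card => y; rewrite !inE andbT eq_sym.
Qed.

Definition low_degree : {set T} := [set x | (degree G x).*2 < n].

Lemma card_setC_low : #|low_degree| + #|~: low_degree| = n.
Proof. by rewrite cardsC. Qed.

Hypothesis cG : ore_closed G.
Local Notation B := low_degree.
Local Notation C := (~: low_degree).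

Lemma high_clique : {in C &, forall x y, x != y -> G x y}.
Proof.
move=> x y; rewrite !inE => hx hy xy; apply: contraT => nxy.
by have := cG xy nxy; rewrite nT; lia.
Qed.

Lemma high_degree x : x \in C -> #|C| <= (degree G x).+1.
Proof.
move=> xC; rewrite (cardsD1 x) xC add1n ltnS; apply/subset_leq_card/subsetP => y.
by rewrite in_setD1 inE => /andP[yx yC]; apply: high_clique; rewrite // eq_sym.
Qed.

(** A low vertex misses some [c] of the clique [C], else its degree would reach n/2. As [c] has
    degree at least |C| - 1, closedness leaves [b] at most n - |C|. *)
Lemma low_degree_le b : b \in B -> (#|B|).*2 <= n -> degree G b <= #|B|.
Proof.
move=> bB hB; have [c cC nbc] : exists2 c, c \in C & ~~ G b c.
  apply/exists_inP; apply: contraTT bB => /exists_inPn h; rewrite inE -leqNgt.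
  have : #|C| <= degree G b.
    by apply/subset_leq_card/subsetP => c /h; rewrite inE negbK.
  by have := card_setC_low; lia.
have bc : b != c by apply: contraTneq cC => <-; rewrite inE bB.
have := cG bc nbc; rewrite nT; have := high_degree cC; have := card_setC_low; lia.
Qed.

Variables (s c : nat).
Hypothesis s2 : 2 <= s.
Hypothesis dG : min_degree_ge G s.
Hypothesis hN : \sum_x codegree x <= 2 * (s * n + c).
Hypothesis hT : 2 * c + 10 * s.+1 ^ 2 <= n.

(** Each low vertex has codegree at least (n - 1)/2. This first bound makes [low_degree_le]
    applicable. *)
Lemma card_low_crude : #|B| <= 4 * s + 1.
Proof.
rewrite leqNgt; apply/negP => hB.
have : #|B| * (n - 1) <= 2 * (2 * (s * n + c)).
  apply: leq_trans (leq_mul (leqnn 2) hN); rewrite big_distrr /=.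
  rewrite (bigID (mem B)) /=; apply: leq_trans (leq_addr _ _).
  rewrite -sum_nat_const; apply: leq_sum => x; rewrite inE => hx.
  by have := degree_codegree x; lia.
move/(leq_trans (leq_mul hB (leqnn (n - 1)))); nia.
Qed.

(** The missing pairs between [B] and [C] are counted from both ends: a low vertex has codegree at
    least n - |B| - 1, of which at least |C| - |B| lies in [C]. *)
Lemma codegree_low_sum :
  #|B| * (2 * n - 3 * #|B| - 1) <= \sum_x codegree x.
Proof.
have hB := card_low_crude.
have hb b : b \in B -> degree G b <= #|B| by move=> bB; apply: low_degree_le; lia.
rewrite (bigID (mem B)) /=.
have -> : #|B| * (2 * n - 3 * #|B| - 1) =
    #|B| * (n - #|B| - 1) + #|B| * (#|C| - #|B|).
  by rewrite -mulnDr; congr muln; have := card_setC_low; nia.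
apply: leq_add.
  rewrite -sum_nat_const; apply: leq_sum => x xB.
  by have := degree_codegree x; have := hb _ xB; lia.
apply: leq_trans (_ : \sum_(x in C) \sum_(b in B) ~~ G x b <= _); last first.
  rewrite [leqRHS](eq_bigl (fun x => x \in C)); last by move=> x; rewrite in_setC.
  apply: leq_sum => x xC; rewrite -big_mkcondr /= sum1dep_card.
  apply/subset_leq_card/subsetP => b; rewrite !inE => /andP[bB ->].
  by rewrite andbT; apply: contraTneq xC => ->; rewrite !inE negbK.
rewrite exchange_big /= -sum_nat_const; apply: leq_sum => b bB.
rewrite -big_mkcondr /= sum1dep_card.
apply: leq_trans (leq_sub2l _ (hb b bB)) _.
rewrite leq_subLR -(cardsID [set y | G b y] C); apply: leq_add.
  by apply/subset_leq_card/subsetIr.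
by apply/subset_leq_card/subsetP => y; rewrite !inE (adj_sym G y) andbC.
Qed.

(** With s + 1 low vertices the codegree sum would be at least 2 (s + 1) n up to a constant, beyond
    [hN] for large n. *)
Lemma card_low_le : #|B| <= s.
Proof.
rewrite leqNgt; apply/negP => sB.
have := leq_trans codegree_low_sum hN; have := card_low_crude.
move=> h1; apply/negP; rewrite -ltnNge.
apply: leq_trans (leq_mul sB (leq_sub2r 1 (leq_sub2l _ (leq_mul (leqnn 3) h1)))).
nia.
Qed.


Hypothesis nH : ~ hamiltonian G.

(** [B] is nonempty, since otherwise [G] is complete; then s <= deg b <= |B| <= s. *)
Lemma card_low_eq : #|B| = s /\ {in B, forall b, degree G b = s}.
Proof.
have Bs := card_low_le.
have hb b : b \in B -> degree G b <= #|B|.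
  by move=> bB; apply: low_degree_le => //; nia.
have [b bB] : exists b, b \in B.
  apply/set0Pn; apply/eqP => B0; apply: nH; apply: hamiltonian_complete.
    by rewrite nT; nia.
  by move=> x y xy; apply: high_clique; rewrite // B0 !inE.
have eB : #|B| = s by have := hb _ bB; have := dG b; lia.
by split=> // x xB; have := hb _ xB; have := dG x; lia.
Qed.

Definition attachment : {set T} := [set c in C | [exists b in B, G c b]].
Local Notation Y := attachment.

(** One neighbour in [B] lifts the degree of [y] to |C| = n - s. Added to the degree s of any [b]
    this reaches n, so closedness forces the edge. *)
Lemma attachment_full y b : y \in Y -> b \in B -> G y b.
Proof.
have [Bs hb] := card_low_eq.
rewrite inE => /andP[yC /exists_inP[b' b'B yb']] bB; apply: contraT => nyb.
have yb : y != b by apply: contraTneq yC => ->; rewrite inE bB.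
have := cG yb nyb; rewrite nT (hb b bB) => hd.
have : #|b' |: (C :\ y)| <= degree G y.
  apply/subset_leq_card/subsetP => x; rewrite in_setU1 in_setD1 inE.
  case/orP=> [/eqP->//|/andP[xy xC]].
  by apply: high_clique; rewrite // eq_sym.
rewrite cardsU1 in_setD1 [b' \in C]inE b'B andbF /=.
have := cardsD1 y C; rewrite yC; have := card_setC_low; lia.
Qed.

Lemma low_neighbour b x : b \in B -> G b x -> x \in B :|: Y.
Proof.
move=> bB bx; rewrite in_setU; case: (boolP (x \in B)) => //= xB.
by rewrite !inE in xB *; rewrite xB /=; apply/exists_inP; exists b; rewrite // adj_sym.
Qed.

Lemma low_disjoint : [disjoint B & Y].
Proof. by rewrite disjoint_sym disjoints_subset; apply/subsetP=> x; rewrite inE => /andP[]. Qed.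

Lemma degree_low b : b \in B -> #|[set x in B | G b x]| + #|Y| = s.
Proof.
move=> bB; have [_ /(_ b bB)<-] := card_low_eq.

rewrite /degree -cardsUI [X in _ + X = _]eq_card0 ?addn0; last first.
  move=> x; rewrite in_setI [x \in [set _ | _]]inE.
  case: (boolP (x \in B)) => //= xB.
  by rewrite (disjointFr low_disjoint xB) andbF.
apply: eq_card => x; rewrite in_setU.
have -> : (x \in [set y in B | G b y]) = (x \in B) && G b x by rewrite inE.
have -> : (x \in [set y | G b y]) = G b x by rewrite inE.
case: (boolP (x \in Y)) => xY; first by rewrite orbT adj_sym attachment_full.
rewrite orbF; case: (boolP (G b x)) => [bx|]; last by rewrite andbF.
by have := low_neighbour bB bx; rewrite in_setU (negPf xY) orbF => ->.
Qed.

(* If [2 <= #|Y| < s], contract the vertices outside [B] and [Y] to one of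
   them: on the resulting [s + #|Y| + 1 <= 2 * s] vertices Ore's condition
   completes the graph. *)
Lemma attachment_card : #|Y| = 1 \/ #|Y| = s.
Proof.
have [Bs hb] := card_low_eq.
have [b0 b0B] : exists b, b \in B by apply/set0Pn; rewrite -card_gt0; lia.
have Ys b : b \in B -> 0 < #|Y| <= s.
  move=> bB; have := degree_low bB.
  have : #|[set x in B | G b x]| <= #|B :\ b|.
    apply/subset_leq_card/subsetP => x; rewrite !inE => /andP[-> bx].
    by rewrite andbT; apply: contraTneq bx => ->; rewrite adj_irr.
  by have := cardsD1 b B; rewrite bB; lia.
have {}Ys := Ys _ b0B.
case: (eqVneq #|Y| 1) => [|Y1]; first by left.
case: (eqVneq #|Y| s) => [|Yns]; first by right.
exfalso; pose A := B :|: Y; pose Z := ~: A.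
have cardA : #|A| = s + #|Y|.
  by rewrite cardsU disjoint_setI0 ?low_disjoint // cards0 subn0 Bs.
have [z zZ] : exists z, z \in Z.
  have n2s : 2 * s < n by nia.
  by apply/set0Pn; rewrite -card_gt0; have := cardsC A; rewrite nT cardA /Z; lia.
have ZC x : x \in Z -> x \in C.
  by rewrite !in_setC in_setU negb_or => /andP[].
have YC x : x \in Y -> x \in C by rewrite inE => /andP[].
have zA : z \notin A by rewrite in_setC in zZ.
have ZB x b : x \in Z -> b \in B -> ~~ G b x.
  by move=> xZ bB; apply: contraTN xZ => /(low_neighbour bB); rewrite in_setC negbK.
apply: nH; apply: (@hamiltonian_blowup _ _ A Z z) => //.
- by rewrite /Z setCK.
- by move=> x y /ZC xC /ZC yC; apply: high_clique.
- move=> x y xZ; rewrite in_setU => /orP[yB|yY _].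
    by rewrite adj_sym (negPf (ZB z y zZ yB)).
  apply: high_clique; rewrite ?(ZC x xZ) ?(YC y yY) //.
  by apply: contraTneq xZ => ->; rewrite in_setC in_setU yY orbT.
set F := induced G (z |: A).
have [H [FH cH]] := ore_closure F; apply.
have cardzA : #|z |: A| = s + #|Y| + 1 by rewrite cardsU1 zA cardA addnC.
have cardF : #|{: {x : T | x \in z |: A}}| = s + #|Y| + 1.
  by rewrite card_induced.
pose inB (x : {x : T | x \in z |: A}) := val x \in B.
have dB x : inB x -> s <= degree H x.
  move=> xB; apply: leq_trans (degree_sub _ FH); rewrite degree_induced -(hb _ xB).
  apply/subset_leq_card/subsetP => y; rewrite !inE => xy.
  by rewrite xy andbT; have := low_neighbour xB xy; rewrite !inE => ->; rewrite orbT.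
(* The degree sum is at least 2 s >= s + |Y| + 1, because |Y| < s. *)
have clB x y : inB x -> inB y -> x != y -> H x y.
  move=> xB yB xy; apply: contraT => nxy.
  have := cH x y xy nxy; rewrite cardF; have := dB _ xB; have := dB _ yB; lia.
have YH x y : val x \in Y -> x != y -> H x y.
  move=> xY xy; apply: FH; rewrite /F /= /induced_rel.
  case: (boolP (val y \in B)) => [yB|yB]; first exact: attachment_full.
  by apply: high_clique; rewrite ?(YC _ xY) ?in_setC // (inj_eq val_inj).
(* Here [x] sees [Y], while [y] sees [Y] and the rest of [B]: the sum 2 |Y| + s - 1 is at least s +
   |Y| + 1, because |Y| >= 2. *)
have zH x y : val x = z -> inB y -> H x y.
  move=> xz yB.
  have xy : x != y.
    apply: contraNneq zA => xy; rewrite in_setU; move: yB.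
    by rewrite /inB -xy xz => ->.
  apply: contraT => nxy; have := cH x y xy nxy; rewrite cardF.
  have : #|Y| <= degree H x.
    have YA : Y \subset z |: A by rewrite setUA subsetUr.
    rewrite -(card_induced_set YA).
    apply/subset_leq_card/subsetP => u; rewrite inE => uY.
    rewrite inE adj_sym; apply: YH => //.
    by apply: contraNneq zA => ux; rewrite -xz -ux in_setU uY orbT.
  have : #|Y| + s - 1 <= degree H y.
    rewrite addnC -cardA -(card_induced_set (subsetUr [set z] A)).
    rewrite (cardsD1 y) inE in_setU [val y \in B]yB add1n subn1 /=.
    apply/subset_leq_card/subsetP => u; rewrite in_setD1 inE => /andP[uy].
    rewrite in_setU => /orP[uB|uY]; first by rewrite inE; apply: clB; rewrite // eq_sym.
    by rewrite inE adj_sym YH.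
  lia.
apply: hamiltonian_complete; first by rewrite cardF; lia.
move=> x y xy.
have := valP x; rewrite in_setU1 in_setU => /or3P[/eqP xz|xB|xY].
- have := valP y; rewrite in_setU1 in_setU => /or3P[/eqP yz|yB|yY].
  + by case/eqP: xy; apply: val_inj; rewrite xz yz.
  + exact: zH.
  + by rewrite adj_sym YH // eq_sym.
- have := valP y; rewrite in_setU1 in_setU => /or3P[/eqP yz|yB|yY].
  + by rewrite adj_sym zH.
  + exact: clB.
  + by rewrite adj_sym YH // eq_sym.
- exact: YH.
Qed.
End Structure.

(** * From Ore-closed graphs to arbitrary graphs and vertex deletion *)

Lemma codegree_sub (T : finType) (G H : sgraph T) x :
  subrel G H -> codegree H x <= codegree G x.
Proof.
move=> GH; apply/subset_leq_card/subsetP => y; rewrite !inE => /andP[->].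
by apply: contra; apply: GH.
Qed.

(** The sets come from the Ore closure, so neighbourhoods in [G] are only bounded from above. If |W|
    = s, the closure degree s is used up by [W], and no edges remain inside [B]. *)
Lemma nonhamiltonian_structure (T : finType) (G : sgraph T) (s c : nat) :
  2 <= s -> min_degree_ge G s -> \sum_x codegree G x <= 2 * (s * #|T| + c) ->
  2 * c + 10 * s.+1 ^ 2 <= #|T| -> ~ hamiltonian G ->
  exists B W : {set T}, [/\ #|B| = s, [disjoint B & W] &
    (#|W| = s /\ forall b x, b \in B -> G b x -> x \in W) \/
    (#|W| = 1 /\ forall b x, b \in B -> G b x -> x \in B :|: W)].
Proof.
move=> s2 dG hN hT nG; have [H [GH cH hH]] := ore_closure G.
have {nG}nH : ~ hamiltonian H by move/hH.
have dH : min_degree_ge H s by move=> x; apply: leq_trans (degree_sub x GH).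
have {}hN : \sum_x codegree H x <= 2 * (s * #|T| + c).
  by apply: leq_trans hN; apply: leq_sum => x _; apply: codegree_sub.
exists (low_degree H #|T|), (attachment H #|T|).
have [Bs _] := card_low_eq erefl cH s2 dH hN hT nH.
split=> //; first exact: low_disjoint.
have nb b x : b \in low_degree H #|T| -> G b x ->
    x \in low_degree H #|T| :|: attachment H #|T|.
  by move=> bB /GH; apply: low_neighbour.
have [W1|Ws] := attachment_card erefl cH s2 dH hN hT nH; [by right | left].
split=> // b x bB bx; have := nb b x bB bx; rewrite in_setU => /orP[xB|//].
have := degree_low erefl cH s2 dH hN hT nH bB; rewrite Ws => e.
have /eqP : #|[set x in low_degree H #|T| | H b x]| = 0 by lia.
by rewrite cards_eq0 => /eqP/setP/(_ x); rewrite !inE GH // andbT; move: xB; rewrite inE => ->.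
Qed.

(** Putting [S] back, the neighbours of a vertex of [X] lie in a set of at most d vertices. The
    minimum degree forces equality ([sat]), which fixes both the adjacencies and |Y|. *)
Lemma k_hamiltonian_structure (T : finType) (G : sgraph T) (k d : nat) :
  k + 2 <= d -> min_degree_ge G d ->
  \sum_x codegree G x <= 2 * ((d - k) * #|T|) ->
  k + 2 * ((d - k) * k) + 10 * (d - k).+1 ^ 2 <= #|T| ->
  ~ k_hamiltonian G k ->
  exists X Y : {set T}, [/\ #|X| = d - k, [disjoint X & Y] &
    (#|Y| = d /\ forall x y, x \in X -> G x y = (y \in Y)) \/
    (#|Y| = k.+1 /\
       forall x y, x \in X -> G x y = (x != y) && (y \in X :|: Y))].
Proof.
move=> kd dG hN hT /existsNP[S /not_implyP[Sk nF]].
pose s := d - k; pose F := induced G (~: S).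
have cS : #|S| + #|~: S| = #|T| by rewrite cardsC.
have cT' : #|{: {x : T | x \in ~: S}}| = #|~: S| by rewrite card_induced.
have dF : min_degree_ge F s.
  move=> x; rewrite degree_induced.
  have := dG (val x); rewrite /degree -(cardsID S) => h.
  have : #|[set y | G (val x) y] :&: S| <= #|S| by apply/subset_leq_card/subsetIr.
  suff -> : [set y in ~: S | G (val x) y] = [set y | G (val x) y] :\: S by lia.
  by apply/setP => y; rewrite !inE.
(* The slack s k pays for replacing #|T| by the number of vertices left after deleting at most k. *)
have hF : \sum_x codegree F x <= 2 * (s * #|{: {x : T | x \in ~: S}}| + s * k).
  apply: (@leq_trans (\sum_(x in ~: S) codegree G x)).
    rewrite [leqRHS]big_sub -[leqRHS]/(\sum_(x : {x | x \in ~: S}) codegree G (val x)).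
    apply: leq_sum => x _.
    rewrite /codegree -(card_imset _ val_inj).
    apply/subset_leq_card/subsetP => _ /imsetP[y hy ->].
    by move: hy; rewrite !inE (inj_eq val_inj).
  rewrite cT'; apply: leq_trans (leq_trans _ hN) _; last by nia.
  by rewrite [leqRHS](bigID (mem (~: S))) leq_addr.
have bF : 2 * (s * k) + 10 * s.+1 ^ 2 <= #|{: {x : T | x \in ~: S}}|.
  by rewrite cT'; lia.
have s2 : 2 <= s by lia.
have [B [W [Bs BW hBW]]] := nonhamiltonian_structure s2 dF hF bF nF.
pose X := [set val b | b in B]; pose V := [set val w | w in W].
have cX : #|X| = s by rewrite card_imset //; apply: val_inj.
have cV : #|V| = #|W| by rewrite card_imset //; apply: val_inj.
have inX b : (val b \in X) = (b \in B) by rewrite mem_imset //; apply: val_inj.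
have inV b : (val b \in V) = (b \in W) by rewrite mem_imset //; apply: val_inj.
have XS : [disjoint X & S].
  by rewrite disjoints_subset; apply/subsetP=> _ /imsetP[b _ ->]; apply: valP.
have XV : [disjoint X & V].
  rewrite disjoints_subset; apply/subsetP=> _ /imsetP[b bB ->].
  by rewrite inE inV (disjointFr BW bB).
exists X, (S :|: V).
have cSV : #|S :|: V| <= k + #|W| by rewrite cardsU cV; lia.
have nbh x y (D : {set {x : T | x \in ~: S}}) :
    x \in X -> (forall b w, b \in B -> F b w -> w \in D) ->
    G x y -> y \in S :|: [set val w | w in D].
  case/imsetP => b bB ->{x} hD xy; rewrite in_setU.
  case: (boolP (y \in S)) => //= yS.
  have yS' : y \in ~: S by rewrite inE.
  apply/imsetP; exists (Sub y yS') => //.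
  exact: (hD b).
have sat x (N : {set T}) : #|N| <= d -> (forall y, G x y -> y \in N) ->
    #|N| = d /\ forall y, G x y = (y \in N).
  move=> Nd sub; have dx := dG x.
  have e : [set y | G x y] = N.
    apply/eqP; rewrite eqEcard (leq_trans Nd dx) andbT.
    by apply/subsetP=> y; rewrite inE; apply: sub.
  by split=> [|y]; rewrite -e ?inE //; apply/eqP; rewrite eqn_leq dx andbT e.
have [x0 x0X] : exists x, x \in X by apply/set0Pn; rewrite -card_gt0; lia.
have XSV : [disjoint X & S :|: V].
  rewrite disjoints_subset; apply/subsetP => x xX.
  by rewrite !inE (disjointFr XS xX) (disjointFr XV xX).
split=> //; case: hBW => [] [cW hW]; [left | right].
  have satX x : x \in X -> #|S :|: V| = d /\ forall y, G x y = (y \in S :|: V).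
    by move=> xX; apply: sat => [|y]; [lia | exact: nbh].
  by split=> [|x y /satX[_]//]; have [] := satX _ x0X.
have satX x : x \in X -> #|(X :\ x) :|: (S :|: V)| = d /\
    forall y, G x y = (y \in (X :\ x) :|: (S :|: V)).
  move=> xX; apply: sat => [|y xy].
    by rewrite cardsU; have := cardsD1 x X; rewrite xX; lia.
  have := nbh _ _ _ xX hW xy; rewrite !in_setU in_setD1.
  have -> : y != x by apply: contraTneq xy => ->; rewrite adj_irr.
  case/orP=> [->|/imsetP[w]]; first by rewrite orbT.
  by rewrite in_setU => /orP[]wD ->; rewrite ?(inX, inV) wD ?orbT.
split=> [|x y xX].
  have [+ _] := satX _ x0X; rewrite cardsU.
  by have := cardsD1 x0 X; rewrite x0X; lia.
have [_ ->] := satX _ xX; rewrite !(in_setU y) in_setD1 eq_sym.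
case: eqVneq => [<-|] //=.
by have := disjointFr XSV xX; rewrite in_setU.
Qed.

(** * Spectral estimates *)

Section Eigenvector.
Variables (R : realFieldType) (T : finType) (G : sgraph T).
Local Open Scope ring_scope.

Definition nbr (x : T) : {set T} := [set y | G x y].

Definition signless_eigenvector (q : R) (v : T -> R) : Prop :=
  forall i, q * v i = (degree G i)%:R * v i + \sum_(j in nbr i) v j.

Lemma sum_degree_codegree :
  (\sum_x degree G x + \sum_x codegree G x + #|T| = #|T| * #|T|)%N.
Proof.
rewrite -[in X in (_ + X)%N]sum1_card -!big_split /= -sum_nat_const.
by apply: eq_bigr => x _; rewrite addn1 (degree_codegree G erefl).
Qed.

Lemma norm_sum_le (A : {set T}) (v : T -> R) c :
  {in A, forall j, `|v j| <= c} -> `|\sum_(j in A) v j| <= #|A|%:R * c.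
Proof.
move=> h; apply: le_trans (ler_norm_sum _ _ _) _.
rewrite mulr_natl -sumr_const; exact: ler_sum.
Qed.

(* With [u] maximizing [|v u| / d(u)], the eigenvalue equation gives
   [q <= d(u) + m(u)], where [m(u)] is the average degree of the neighbours. *)
Lemma codegree_sum_le q v (s : nat) :
  signless_eigenvector q v -> (exists i, v i != 0) ->
  (forall i, 0 < degree G i)%N -> (s < #|T|)%N ->
  2 * (#|T|%:R - s%:R - 1) <= q ->
  (\sum_x codegree G x <= 2 * (s * #|T|))%N.
Proof.
move=> ev [i0 vi0] d0 sT hq.
pose d x : R := (degree G x)%:R.
have d_gt0 x : 0 < d x by rewrite ltr0n.
pose y x := `|v x| / d x.
have [u _ uP] := @Order.TotalTheory.arg_maxP _ R T i0 xpredT y isT.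
have yu : 0 < y u.
  by apply: lt_le_trans (uP i0 isT); rewrite divr_gt0 // normr_gt0.
have vE x : `|v x| = y x * d x by rewrite /y divfK // gt_eqF.
have key : (q - d u) * d u <= \sum_(w in nbr u) d w.
  rewrite -(ler_pM2l yu) mulrCA -vE mulr_sumr.
  apply: le_trans (ler_wpM2r (normr_ge0 _) (ler_norm _)) _.
  rewrite -normrM; have -> : (q - d u) * v u = \sum_(j in nbr u) v j.
    by rewrite mulrBl ev /d; ring.
  apply: le_trans (ler_norm_sum _ _ _) _; apply: ler_sum => j _.
  by rewrite vE; apply: ler_wpM2r; [exact: ltW (d_gt0 j) | exact: uP].
have {key} : (2 * (#|T| - s - 1) * degree G u <=
    \sum_(w in nbr u) degree G w + degree G u * degree G u)%N.
  rewrite -(ler_nat R) natrD !natrM natr_sum -lerBlDr -mulrBl.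
  apply: le_trans key; rewrite ler_wpM2r ?ler0n // lerD2r.
  apply: le_trans hq; rewrite !natrB ?subn_gt0 //; last exact: ltnW.
set S := (\sum_(w in nbr u) degree G w)%N => key.
have Sd : (S + degree G u <= \sum_x degree G x)%N.
  rewrite (bigID (mem (nbr u))) /= leq_add2l (bigD1 u) ?inE ?adj_irr //=.
  exact: leq_addr.
have Sle : (S <= degree G u * (#|T| - 1))%N.
  rewrite /S -sum_nat_const; apply: leq_sum => w _.
  by have := degree_codegree G erefl w; lia.
have := sum_degree_codegree; have := degree_codegree G erefl u.
have := d0 u; move: sT key Sd Sle; move: (degree G u) (codegree G u) #|T| S.
move: (\sum_x degree G x)%N (\sum_x codegree G x)%N.
move=> m m' d' t n S sn key Sd Sle d'0 tE mE.
have ts : (t <= 2 * s)%N.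
  by have : (2 * (n - s - 1) <= n - 1 + d')%N; nia.
(* Here m and m' are the degree and codegree sums. With d' = n - 1 - t, the next bound gives m >= d'
   (2n - 2s - 1 - d') = n^2 - (2s + 1) n + (2s - t)(t + 1), and t <= 2s. *)
suff : (n * n <= m + (2 * s + 1) * n)%N by nia.
have : (2 * (n - s - 1) * d' + d' <= m + d' * d')%N by nia.
nia.
Qed.

End Eigenvector.

(** * Missing edges outside the low-degree set *)

Section MissingEdges.
Variables (R : realFieldType) (T : finType) (G : sgraph T).
Variables (X : {set T}) (s d K n : nat).
Local Open Scope ring_scope.
Hypotheses (nT : #|T| = n) (cX : #|X| = s).
Hypothesis dX : {in X, forall b, degree G b = d}.

Definition inner i := #|nbr G i :&: X|.
Definition outer i := #|nbr G i :\: X|.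
(* Summed over [~: X], this counts every edge missing outside [X] twice. *)
Definition missing i := #|(~: X :\: nbr G i) :\ i|.

Lemma degree_split i : degree G i = (inner i + outer i)%N.
Proof. by rewrite /degree -(cardsID X). Qed.

Lemma outer_missing i : i \notin X -> (outer i + missing i + s).+1 = n.
Proof.
move=> iX; have := cardsC X; have := cardsID (nbr G i) (~: X).
have := cardsD1 i (~: X :\: nbr G i); rewrite !inE adj_irr iX /= => -> <-.
have -> : outer i = #|~: X :&: nbr G i| by rewrite /outer setDE setIC.
by rewrite /missing nT cX; lia.
Qed.

Lemma sum_inner : (\sum_(i in ~: X) inner i = \sum_(b in X) outer b)%N.
Proof.
have -> : (\sum_(i in ~: X) inner i = \sum_(i in ~: X) \sum_(b in X) G i b)%N.
  apply: eq_bigr => i _; rewrite -big_mkcondr sum1dep_card.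
  by apply: eq_card => b; rewrite !inE andbC.
rewrite exchange_big; apply: eq_bigr => b _ /=.
rewrite -big_mkcondr sum1dep_card; apply: eq_card => i.
by rewrite !inE (adj_sym G b).
Qed.

(** For i outside [X], codegree + [inner] = [missing] + s. Subtracting the pairs that meet [X] from
    the total cancels the terms in n. *)
Lemma sum_missing_le :
  (\sum_x codegree G x <= 2 * (s * n))%N ->
  (\sum_(i in ~: X) missing i <= s * (s + 2 * d + 1))%N.
Proof.
move=> hN.
have e1 : (\sum_(b in X) codegree G b = s * (n - d - 1))%N.
  rewrite -cX -sum_nat_const; apply: eq_bigr => b bX.
  by have := degree_codegree G nT b; rewrite (dX bX); lia.
have e2 : (\sum_(b in X) outer b <= s * d)%N.
  rewrite -cX -sum_nat_const; apply: leq_sum => b bX.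
  by rewrite -(dX bX) degree_split leq_addl.
have e3 : (\sum_(i in ~: X) codegree G i + \sum_(i in ~: X) inner i =
    \sum_(i in ~: X) missing i + s * (n - s))%N.
  have -> : (s * (n - s) = \sum_(i in ~: X) s)%N.
    by rewrite sum_nat_const mulnC; congr muln; have := cardsC X; rewrite nT; lia.
  rewrite -!big_split; apply: eq_bigr => i; rewrite in_setC => iX.
  by have := degree_codegree G nT i; have := outer_missing iX;
     rewrite degree_split /=; lia.
have e4 : (\sum_x codegree G x =
    \sum_(b in X) codegree G b + \sum_(i in ~: X) codegree G i)%N.
  rewrite (bigID (mem X)); congr addn.
  by apply: eq_bigl => i; rewrite in_setC.
move: hN; rewrite e4 e1; rewrite sum_inner in e3; nia.
Qed.

Variables (q : R) (v : T -> R) (p : T).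
Hypotheses (ev : signless_eigenvector G q v) (vp : v p = 1).
Hypothesis v1 : forall i, `|v i| <= 1.
Hypothesis hq : 2 * (n%:R - s%:R - 1) <= q.
Hypothesis hK : (\sum_(i in ~: X) missing i <= K)%N.
(** The O(1/n) deviation of [v]: [de] serves the bound on [X], [Ke] the one outside. *)
Variable e : R.
Hypotheses (e0 : 0 <= e) (e1 : e < 1).
Hypothesis hn : (2 * s + 2 + d <= n)%N.
Hypothesis de : d%:R <= n%:R * e.
Hypothesis Ke : 4 * (K + s)%:R <= (n - s)%:R * e.

Let hnR : 2 * s%:R + 2 + d%:R <= n%:R :> R.
Proof. by rewrite -natrM -!natrD ler_nat. Qed.

Let sn : (s < n)%N. Proof. by move: hn; lia. Qed.

Let n0 : 0 < n%:R :> R. Proof. by rewrite ltr0n; lia. Qed.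

(** (q - d) v(b) is a sum of d entries of size at most 1, and q - d >= n. *)
Lemma eigenvector_inside b : b \in X -> `|v b| <= e.
Proof.
move=> bX; rewrite -(ler_pM2l n0); apply: le_trans de.
have h : `|(q - d%:R) * v b| <= d%:R.
  have -> : (q - d%:R) * v b = \sum_(j in nbr G b) v j.
    by rewrite mulrBl ev (dX bX); ring.
  rewrite -(dX bX) -[leRHS]mulr1; apply: norm_sum_le => j _; exact: v1.
apply: le_trans h; rewrite normrM; apply: ler_wpM2r => //.
by apply: le_trans _ (ler_norm _); move: hq hnR; lra.
Qed.

Let S := \sum_(j in ~: X) v j.

Lemma sum_nbr_outside i : i \notin X -> \sum_(j in nbr G i) v j =
  S - v i - \sum_(j in (~: X :\: nbr G i) :\ i) v j + \sum_(j in nbr G i :&: X) v j.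
Proof.
move=> iX; rewrite /S (big_setID X) /= addrC; congr (_ + _).
rewrite [X in _ = X - _ - _](big_setID (nbr G i)) /= setIC -setDE.
rewrite [X in _ = _ + X - _ - _](big_setD1 i) /=; first by ring.
by rewrite !inE adj_irr iX.
Qed.

(** The error against the ideal case of a clique outside [X] with no edges to [X], where the
    eigenvalue equation makes it 0. *)
Let eps i := (q - n%:R + s%:R + 2) * v i - S.

Lemma eps_le i : i \notin X -> `|eps i| <= 2 * (K + s)%:R.
Proof.
move=> iX.
have -> : eps i = ((inner i)%:R - (missing i)%:R) * v i
    - \sum_(j in (~: X :\: nbr G i) :\ i) v j + \sum_(j in nbr G i :&: X) v j.
  rewrite /eps; have := ev i; rewrite (sum_nbr_outside iX) degree_split natrD.
  have -> : n%:R = (outer i)%:R + (missing i)%:R + s%:R + 1 :> R.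
    by rewrite -(outer_missing iX) -natr1 !natrD.
  lra.
have mK : (missing i <= K)%N.
  by apply: leq_trans hK; rewrite (bigD1 i) ?in_setC //= leq_addr.
have xs : (inner i <= s)%N by rewrite -cX; apply/subset_leq_card/subsetIr.
have h1 : `|\sum_(j in (~: X :\: nbr G i) :\ i) v j| <= (missing i)%:R.
  by rewrite -[leRHS]mulr1; apply: norm_sum_le => j _.
have h2 : `|\sum_(j in nbr G i :&: X) v j| <= (inner i)%:R.
  by rewrite -[leRHS]mulr1; apply: norm_sum_le => j _.
have h3 : `|((inner i)%:R - (missing i)%:R) * v i| <= (inner i)%:R + (missing i)%:R.
  rewrite normrM -[leRHS]mulr1; apply: ler_pM => //.
  by apply: le_trans (ler_normB _ _) _; rewrite !normr_nat.
have h4 : (inner i)%:R + (missing i)%:R <= (K + s)%:R :> R.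
  by rewrite -natrD ler_nat addnC leq_add.
apply: le_trans (ler_normD _ _) _; apply: le_trans (lerD (ler_normB _ _) (lexx _)) _.
lra.
Qed.

(** Comparing [eps] at [i] and at [p] eliminates [S]: (n - s)(1 - v(i)) <= 4 (K + s). The vertex [p]
    is outside [X] because v(p) = 1 > e. *)
Lemma eigenvector_outside i : i \notin X -> 1 - e <= v i <= 1.
Proof.
move=> iX; have vi1 : v i <= 1 by apply: le_trans (v1 i); apply: ler_norm.
rewrite vi1 andbT.
have pX : p \notin X.
  apply: contraTN e1 => /eigenvector_inside; rewrite vp normr1 -leNgt; exact.
have := eps_le iX; have := eps_le pX; rewrite /eps vp.
rewrite !ler_norml => /andP[_ h1] /andP[h2 _].
have ns : 0 < (n - s)%:R :> R by rewrite ltr0n subn_gt0.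
rewrite -subr_ge0 -(pmulr_rge0 _ ns).
have : (n - s)%:R * (1 - v i) <= (q - n%:R + s%:R + 2) * (1 - v i).
  apply: ler_wpM2r; first by rewrite subr_ge0.
  by rewrite natrB; [move: hq; lra | exact: ltnW].
move: Ke; lra.
Qed.

(** The eigenvalue equations are summed: the signless Laplacian maps the all-ones vector to twice
    the degree vector. *)
Lemma eigenvector_degree_sum : \sum_i (q - 2 * (degree G i)%:R) * v i = 0.
Proof.
have h : \sum_i \sum_(j in nbr G i) v j = \sum_i (degree G i)%:R * v i.
  rewrite (exchange_big_dep predT) //=; apply: eq_bigr => j _.
  rewrite sumr_const mulr_natl; congr (_ *+ _).
  by apply: eq_card => i; rewrite [RHS]inE adj_sym -[LHS]/(j \in nbr G i) inE.
have : \sum_i q * v i = \sum_i (degree G i)%:R * v i + \sum_i \sum_(j in nbr G i) v j.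
  by rewrite -big_split; apply: eq_bigr => i _; apply: ev.
rewrite h => {}h.
rewrite -[RHS](subrr (\sum_i q * v i)) {2}h -!big_split /= -sumrB.
by apply: eq_bigr => i _; ring.
Qed.

Hypothesis small_e : (2 * K + 2 * (s * d))%:R * e < 1.

Lemma missing_le_outer :
  (2 * \sum_(i in ~: X) missing i <= \sum_(b in X) outer b)%N.
Proof.
have out i : i \in ~: X ->
    2 * (missing i)%:R * (1 - e) - 2 * (inner i)%:R <= (q - 2 * (degree G i)%:R) * v i.
  rewrite in_setC => iX; have /andP[vl vu] := eigenvector_outside iX.
  have v0 : 0 <= v i by move: e1; lra.
  apply: (@le_trans _ _ (2 * ((missing i)%:R - (inner i)%:R) * v i)).
    have : 0 <= (missing i)%:R :> R by []. have : 0 <= (inner i)%:R :> R by [].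
    nra.
  apply: ler_wpM2r => //; rewrite degree_split.
  move: hq; have <- := outer_missing iX; rewrite -!natr1 !natrD; lra.
have ins b : b \in X ->
    (outer b)%:R - 2 * d%:R * e <= (q - 2 * (degree G b)%:R) * v b.
  move=> bX.
  have -> : (q - 2 * (degree G b)%:R) * v b =
      \sum_(j in nbr G b) v j - (degree G b)%:R * v b.
    by have := ev b; lra.
  have := eigenvector_inside bX; rewrite ler_norml => /andP[_ vb].
  have h1 : (outer b)%:R * (1 - e) <= \sum_(j in nbr G b :\: X) v j.
    rewrite mulr_natl -sumr_const; apply: ler_sum => j.
    by rewrite inE => /andP[jX _]; have /andP[] := eigenvector_outside jX.
  have h2 : `|\sum_(j in nbr G b :&: X) v j| <= (inner b)%:R * e.
    by apply: norm_sum_le => j; rewrite inE => /andP[_]; apply: eigenvector_inside.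
  move: h2; rewrite ler_norml => /andP[h2 _].
  rewrite (big_setID X) /= (dX bX).
  have : d%:R = (inner b)%:R + (outer b)%:R :> R.
    by rewrite -natrD -degree_split dX.
  have : 0 <= d%:R * (e - v b) by apply: mulr_ge0; rewrite // subr_ge0.
  move=> h3 dE; rewrite dE in h3 *; nra.
have := eigenvector_degree_sum; rewrite (bigID (mem X)) /= => h0.
have eC (F : T -> R) : \sum_(i in ~: X) F i = \sum_(i | i \notin X) F i.
  by apply: eq_bigl => i; rewrite in_setC.
have := ler_sum (index_enum T) ins.
have := ler_sum (index_enum T) out.
rewrite !sumrB sumr_const cX -!mulr_suml -!mulr_sumr -!natr_sum sum_inner.
rewrite eC -[_ *+ s]mulr_natl.
move: hK; set D := (\sum_(i in ~: X) missing i)%N.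
set M := (\sum_(b in X) outer b)%N => DleK hC hX.
have DK : D%:R * e <= K%:R * e by apply: ler_wpM2r; rewrite ?ler_nat.
move: small_e; rewrite natrD !natrM => hs.
(* The sums give 2 D - M <= (2 K + 2 s d) e < 1, and D and M are integers. This D counts each
   missing edge twice. *)
rewrite -ltnS -(ltr_nat R) -natr1 natrM; nra.
Qed.
End MissingEdges.

Section Bound.
Variables (R : realFieldType) (T : finType) (G : sgraph T).
Local Open Scope ring_scope.

(* [K] bounds [\sum_(i in ~: X) missing G X i]; from this [n] on, the deviations
   of the eigenvector from 0 and 1 are at most [1 / (2 * K + 2 * (s * d) + 2)]. *)
Definition threshold (s d : nat) : nat :=
  let K := (s * (s + 2 * d + 1))%N in
  (3 * s + 2 + d + (4 * (K + s) + d) * (2 * K + 2 * (s * d) + 2))%N.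

Lemma missing_bound (X : {set T}) (s d : nat) (q : R) (v : T -> R) :
  #|X| = s -> {in X, forall b, degree G b = d} ->
  signless_eigenvector G q v -> (exists i, v i != 0) ->
  2 * (#|T|%:R - s%:R - 1) <= q ->
  (\sum_x codegree G x <= 2 * (s * #|T|))%N -> (threshold s d <= #|T|)%N ->
  (2 * \sum_(i in ~: X) missing G X i <= \sum_(b in X) outer G X b)%N.
Proof.
move=> cX dX ev [i0 vi0] hq hN; rewrite /threshold.
have := sum_missing_le erefl cX dX hN.
set K := (s * _)%N => hK hT.
have [p _ pP] := @Order.TotalTheory.arg_maxP _ R T i0 xpredT (fun i => `|v i|) isT.
have vp0 : v p != 0.
  by rewrite -normr_gt0; apply: lt_le_trans (pP i0 isT); rewrite normr_gt0.
(* Dividing by the entry itself, sign included, makes the entry at [p] equal to +1. *)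
pose w i := v i / v p.
have ew : signless_eigenvector G q w.
  by move=> i; rewrite /w -mulr_suml mulrA ev; ring.
have w1 i : `|w i| <= 1.
  by rewrite /w normrM normfV ler_pdivrMr ?normr_gt0 // mul1r; apply: pP.
have wp : w p = 1 by rewrite /w divff.
pose m := (2 * K + 2 * (s * d) + 2)%N.
have m0 : 0 < m%:R :> R by rewrite ltr0n /m addn2.
apply: (@missing_le_outer R T G X s d K #|T| erefl cX dX q w p ew wp w1 hq hK m%:R^-1).
- by rewrite invr_ge0 ltW.
- by rewrite invf_lt1 // ltr1n /m addn2.
- by lia.
- by rewrite ler_pdivlMr // -natrM ler_nat /m; lia.
- by rewrite ler_pdivlMr // -!natrM ler_nat /m; lia.
- by rewrite ltr_pdivrMr // mul1r ltr_nat /m; lia.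
Qed.

End Bound.

Lemma signless_radius_eigenvector (R : rcfType) n (G : sgraph 'I_n) (q : R) :
  signless_radius G q ->
  exists2 v : 'I_n -> R, signless_eigenvector G q v & exists i, v i != 0%R.
Proof.
case=> /eigenvalueP[v vQ v0] _; exists (fun i => v 0%R i) => [i|]; last first.
  by apply/existsP; apply: contraNT v0 => /existsPn h; apply/eqP/rowP => j;
     rewrite mxE; apply/eqP; have := h j; rewrite negbK.
have /rowP/(_ i) := vQ; rewrite /signless_laplacian mulmxDr /degree_mx mul_mx_diag !mxE => <-.
congr (_ + _)%R.
  exact: mulrC.
rewrite [RHS]big_mkcond /=; apply: eq_bigr => j _.
by rewrite !mxE inE adj_sym; case: (G i j); rewrite ?mulr1 ?mulr0.
Qed.

(** * Membership in the extremal families *)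

Section Family.
Variables (T : finType) (G : sgraph T).

(** Every unordered pair in the image comes from at least two ordered pairs, (x, y) and (y, x). *)
Lemma card_imset_pairs (T' : finType) (f : T -> T') (P : {set T * T}) :
  (forall x y, (x, y) \in P -> (x != y) && ((y, x) \in P)) ->
  2 * #|[set [set f p.1; f p.2] | p in P]| <= #|P|.
Proof.
move=> hP; rewrite -[leqRHS]sum1_card (partition_big_imset (fun p => [set f p.1; f p.2])).
rewrite mulnC -sum_nat_const; apply: leq_sum => _ /imsetP[[x y] xyP ->] /=.
have /andP[xy yxP] := hP _ _ xyP.
rewrite (bigD1 (x, y)) ?xyP ?eqxx //= (bigD1 (y, x)) ?leq_addr //=.
rewrite yxP setUC eqxx; apply: contra xy.
by rewrite xpair_eqE => /andP[].
Qed.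

(** The deleted edges are the images of the nonadjacent pairs outside [X]. The sum of [missing]
    counts ordered pairs, so 4 |E'| <= M. *)
Lemma in_family1_of_bijection (TY TZ TX : finType)
    (G0 : sgraph (TY + (TZ + TX))%type) (f : T -> (TY + (TZ + TX))%type)
    (X : {set T}) (M : nat) :
  bijective f -> (forall x, (x \in X) = (f x \notin YZ TY TZ TX)) ->
  (forall x y, x \in X -> G x y = G0 (f x) (f y)) ->
  (forall x y, x \notin X -> y \notin X -> x != y -> G0 (f x) (f y)) ->
  2 * \sum_(i in ~: X) missing G X i <= M ->
  in_family1 G G0 (M %/ 4).
Proof.
move=> bf fX GX GC hM; have inj_f := bij_inj bf.
pose P := [set p : T * T | (p.1 \in ~: X) && (p.2 \in (~: X :\: nbr G p.1) :\ p.1)].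
have PE x y : (x, y) \in P = [&& x \notin X, y \notin X, x != y & ~~ G x y].
  by rewrite !inE /= (eq_sym y); case: (x \in X); case: (y \in X); case: (x == y);
     rewrite ?andbT ?andbF.
exists [set [set f p.1; f p.2] | p in P]; split.
- apply/subsetP => _ /imsetP[[x y] + ->]; rewrite PE => /and4P[xX yX xy _] /=.
  rewrite inE; apply/andP; split.
    by apply/imsetP; exists (f x, f y); rewrite // inE GC.
  apply/subsetP => u; rewrite !inE => /orP[] /eqP->.
    by have := fX x; rewrite (negPf xX) => /esym/negbFE; rewrite inE.
  by have := fX y; rewrite (negPf yX) => /esym/negbFE; rewrite inE.
- rewrite leq_divRL //; apply: leq_trans hM.
  have -> : \sum_(i in ~: X) missing G X i = #|P|.
    rewrite (eq_bigr (fun i => \sum_(j in (~: X :\: nbr G i) :\ i) 1)).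
      rewrite pair_big_dep -sum1_card; apply: eq_bigl => p.
      by rewrite [RHS]inE.
    by move=> i _; rewrite sum1_card.
  rewrite mulnC -[4]/(2 * 2) -mulnA leq_mul2l /=.
  apply: card_imset_pairs => x y; rewrite !PE => /and4P[-> -> xy nxy].
  by rewrite xy eq_sym xy adj_sym nxy.
exists f => // x y; rewrite /= /delete_rel.
case: (boolP ([set f x; f y] \in _)) => [/imsetP[[a b]]|nE]; last rewrite andbT.
  rewrite PE => /and4P[aX bX ab nab] /= e; rewrite andbF.
  apply/esym/negbTE; apply: contra nab => xy.
  have /setP/(_ (f a)) := e; have /setP/(_ (f b)) := e.
  rewrite !inE !eqxx orbT /= !(inj_eq inj_f).
  case/orP=> /eqP eb; case/orP=> /eqP ea.
  - by rewrite ea eb eqxx in ab.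
  - by rewrite ea eb adj_sym.
  - by rewrite ea eb.
  - by rewrite ea eb eqxx in ab.
case: (boolP (x \in X)) => [xX|xX]; first by rewrite GX.
case: (boolP (y \in X)) => [yX|yX]; first by rewrite adj_sym (adj_sym G) GX.
case: (eqVneq x y) => [->|xy]; first by rewrite !adj_irr.
rewrite GC //; apply/esym; apply: contraNT nE => nxy.
by apply/imsetP; exists (x, y); rewrite // PE xX yX xy.
Qed.

(** The inverse map enumerates the three classes; it is injective, and equal cardinalities make it
    bijective. *)
Lemma three_part_bijection (X Y : {set T}) (a b c : nat) :
  [disjoint X & Y] -> #|Y| = a -> #|X| = b -> #|T| = a + (c + b) ->
  exists f : T -> ('I_a + ('I_c + 'I_b))%type,
    [/\ bijective f, forall x, (x \in Y) = (if f x is inl _ then true else false)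
      & forall x, (x \in X) = (f x \notin YZ _ _ _)].
Proof.
move=> XY cY cX cT; pose Z := ~: (X :|: Y).
have cZ : #|Z| = c.
  have := cardsC (X :|: Y); rewrite cardsU disjoint_setI0 // cards0 cX cY cT /Z; lia.
pose g (u : ('I_a + ('I_c + 'I_b))%type) : T :=
  match u with
  | inl i => enum_val (cast_ord (esym cY) i)
  | inr (inl i) => enum_val (cast_ord (esym cZ) i)
  | inr (inr i) => enum_val (cast_ord (esym cX) i)
  end.
have gP u : match u with
    | inl _ => g u \in Y | inr (inl _) => g u \in Z | inr (inr _) => g u \in X end.
  by case: u => [i|[i|i]]; apply: enum_valP.
have gY u : (g u \in Y) = (if u is inl _ then true else false).
  have := gP u; case: u => [//|[i|i]]; rewrite ?inE ?negb_or.
    by case/andP=> _ /negbTE.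
  by move/(disjointFr XY).
have gX u : (g u \in X) = (u \notin YZ _ _ _).
  have := gP u; case: u => [i|[i|i]]; rewrite [in RHS]inE ?inE ?negb_or /=.
  - by move/(disjointFl XY).
  - by case/andP=> /negbTE.
  - by [].
have inj_g : injective g.
  move=> u w e; have := gY u; have := gX u; rewrite e gY gX !inE; move: e.
  by case: u w => [i|[i|i]] [j|[j|j]] //= /enum_val_inj/cast_ord_inj->.
have [f fK gK] : bijective g.
  by apply: inj_card_bij => //; rewrite !card_sum !card_ord cT.
exists f; split=> [|x|x]; first by exists g.
  by rewrite -{1}[x]gK gY.
by rewrite -{1}[x]gK gX.
Qed.

End Family.

(** * Combination of structure, edge count and family membership *)

Theorem theorem2p7 (k delta : nat) (hdelta : k + 2 <= delta) :
  exists n0 : nat, forall n : nat, n0 <= n ->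
  forall (R : realType) (G : sgraph 'I_n) (q : R),
    min_degree_ge G delta ->
    signless_radius G q ->
    (2 * (n%:R - delta%:R + k%:R - 1) <= q)%R ->
    k_hamiltonian G k \/ in_H1 n k delta G \/ in_L1 n k delta G.
Proof.
pose s := delta - k.
(* The summands serve the eigenvector estimate, the structure lemma, and the truncated subtractions
   in the size of the part Z. *)
exists (threshold s delta + (k + 2 * (s * k) + 10 * s.+1 ^ 2) + 2 * delta).
move=> n hn R G q dG /signless_radius_eigenvector[v ev v0] hq.
case: (EM (k_hamiltonian G k)) => nG; [by left | right].
have cT : #|'I_n| = n := card_ord n.
have {}hq : (2 * (#|'I_n|%:R - s%:R - 1) <= q)%R.
  by rewrite cT /s natrB; [move: hq; lra | lia].
have d0 i : 0 < degree G i by apply: leq_trans (dG i); lia.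
have hs : s < #|'I_n| by rewrite cT /s; lia.
have hN := codegree_sum_le ev v0 d0 hs hq.
have hk : k + 2 * (s * k) + 10 * s.+1 ^ 2 <= #|'I_n| by rewrite cT; lia.
have ht : threshold s delta <= #|'I_n| by rewrite cT; lia.
have [X [Y [cX XY hXY]]] := k_hamiltonian_structure hdelta dG hN hk nG.
(* This evaluates the edges leaving [X] to |Y| s, that is, delta (delta - k) or (k + 1)(delta - k):
   the numerators in the two families. *)
have outerE : (forall b y, b \in X -> y \notin X -> G b y = (y \in Y)) ->
    \sum_(b in X) outer G X b = #|Y| * s.
  move=> h; rewrite mulnC -[s]cX -sum_nat_const; apply: eq_bigr => b bX.
  apply: eq_card => y; rewrite !inE.
  by case: (boolP (y \in X)) => [yX|/(h b y bX)->//]; rewrite (disjointFr XY yX).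
case: hXY => [[cY hG]|[cY hG]]; [left | right].
- have dX : {in X, forall b, degree G b = delta}.
    by move=> b bX; rewrite -cY; apply: eq_card => y; rewrite inE hG.
  have := missing_bound cX dX ev v0 hq hN ht.
  rewrite outerE ?cY => [hm|b y bX _]; last exact: hG.
  have [|f [bf fY fX]] := @three_part_bijection _ X Y delta s (n + k - 2 * delta) XY cY cX.
    by rewrite cT /s; lia.
  apply: (in_family1_of_bijection bf fX _ _ hm).
  + move=> x y xX; rewrite hG // fY; move: xX; rewrite fX inE.
    by case: (f x) => [i|[i|i]] // _; case: (f y) => [j|[j|j]].
  + move=> x y; rewrite !fX !inE !negbK -(inj_eq (bij_inj bf)).
    by case: (f x) => [i|[i|i]] //; case: (f y) => [j|[j|j]].
- have dX : {in X, forall b, degree G b = delta}.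
    move=> b bX; transitivity #|(X :|: Y) :\ b|.
      by apply: eq_card => y; rewrite !inE hG // in_setU eq_sym.
    have := cardsD1 b (X :|: Y); rewrite in_setU bX cardsU disjoint_setI0 //.
    by rewrite cards0 cX cY; lia.
  have := missing_bound cX dX ev v0 hq hN ht.
  rewrite outerE ?cY => [hm|b y bX yX]; last first.
    rewrite hG // in_setU (negPf yX) andb_idl // => _.
    by apply: contraNneq yX => <-.
  have [|f [bf fY fX]] := @three_part_bijection _ X Y k.+1 s (n - delta - 1) XY cY cX.
    by rewrite cT /s; lia.
  apply: (in_family1_of_bijection bf fX _ _ hm).
  + move=> x y xX; rewrite hG // in_setU fY fX -(inj_eq (bij_inj bf)).
    move: xX; rewrite fX !inE.
    by case: (f x) => [i|[i|i]] // _; case: (f y) => [j|[j|j]]; rewrite ?andbT.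
  + move=> x y; rewrite !fX !inE !negbK -(inj_eq (bij_inj bf)).
    by case: (f x) => [i|[i|i]] //; case: (f y) => [j|[j|j]].
Qed.
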